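(* Let $n\ge 1$, $p\ge 2$, let $\mathbf X\in\mathbb R^{n\times p}$ be a nonzero deterministic matrix whose columns satisfy $\|\boldsymbol x^j\|_2^2\le n$, let $\boldsymbol\beta^*\in\mathbb R^p$, $\sigma^*>0$, and $\boldsymbol y=\mathbf X\boldsymbol\beta^*+\boldsymbol\xi$ with $\boldsymbol\xi\sim\mathcal N_n(0,\sigma^{*2}\mathbf I_n)$. Put $r=\operatorname{rank}(\mathbf X)$ and $\bar\nu_r=\max\{\nu_T: T\subset[p],\ |T|=r\}$. Let $\widehat{\boldsymbol\beta}_\lambda$ be any Lasso solution with tuning parameter $\lambda=\sqrt{2\log(p)/n}$. Then for every $\delta\in(0,1)$, with probability at least $1-\delta$, $$\ell_n(\widehat{\boldsymbol\beta}_\lambda,\boldsymbol\beta^* )\le \frac{4\log(p)\,\operatorname{rank}(\mathbf X)}{n\,\bar\nu_r^2}+\frac{4\sigma^{*2}\big(\operatorname{rank}(\mathbf X)+2\log(1/\delta)\big)}{n}.$$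
   Context: $[p]=\{1,\dots,p\}$. A Lasso solution with tuning parameter $\lambda>0$ is any $\widehat{\boldsymbol\beta}_\lambda\in\arg\min_{\boldsymbol\beta\in\mathbb R^p}\{\frac1{2n}\|\boldsymbol y-\mathbf X\boldsymbol\beta\|_2^2+\lambda\|\boldsymbol\beta\|_1\}$ (all solutions give the same $\mathbf X\widehat{\boldsymbol\beta}_\lambda$). The prediction loss is $\ell_n(\boldsymbol\beta,\boldsymbol\beta')=\frac1n\|\mathbf X(\boldsymbol\beta-\boldsymbol\beta')\|_2^2$. For $T\subset[p]$, $\mathbf X_T$ is the submatrix of columns of $\mathbf X$ with index in $T$, and $\nu_T=\inf_{\boldsymbol u\in\mathbb R^{|T|},\,\boldsymbol u\ne0}\frac{\sqrt{|T|}\,\|\mathbf X_T\boldsymbol u\|_2}{\sqrt n\,\|\boldsymbol u\|_1}$. *)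

(* Defs.v *)
From HB Require Import structures.
From mathcomp Require Import all_boot all_order all_algebra.
From mathcomp Require Import all_classical all_reals all_analysis.

Set Implicit Arguments.
Unset Strict Implicit.
Unset Printing Implicit Defensive.

Import Order.TTheory GRing.Theory Num.Theory.
Local Open Scope classical_set_scope.
Local Open Scope ring_scope.

(* The library norm on matrices is the sup norm, hence these two. *)
Definition l1norm (R : realType) (m : nat) (v : 'cV[R]_m) : R :=
  \sum_(i < m) `|v i ord0|.

Definition l2norm (R : realType) (m : nat) (v : 'cV[R]_m) : R :=
  Num.sqrt (\sum_(i < m) v i ord0 ^+ 2).

Definition lasso_objective (R : realType) (n p : nat) (X : 'M[R]_(n, p))
    (y : 'cV[R]_n) (lambda : R) (b : 'cV[R]_p) : R :=
  (2 * n%:R)^-1 * l2norm (y - X *m b) ^+ 2 + lambda * l1norm b.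

Definition lasso_solution (R : realType) (n p : nat) (X : 'M[R]_(n, p))
    (y : 'cV[R]_n) (lambda : R) (b : 'cV[R]_p) : Prop :=
  forall b' : 'cV[R]_p,
    lasso_objective X y lambda b <= lasso_objective X y lambda b'.

Definition prediction_loss (R : realType) (n p : nat) (X : 'M[R]_(n, p))
    (b b' : 'cV[R]_p) : R :=
  n%:R^-1 * l2norm (X *m (b - b')) ^+ 2.

Definition col_submx (R : realType) (n p : nat) (X : 'M[R]_(n, p))
    (T : {set 'I_p}) : 'M[R]_(n, #|T|) :=
  colsub (fun k : 'I_#|T| => enum_val k) X.

(* For [T] empty there is no [u != 0] and the value is the junk [inf set0 = 0];
   it is only used below for nonempty [T]. *)
Definition nu (R : realType) (n p : nat) (X : 'M[R]_(n, p))
    (T : {set 'I_p}) : R :=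
  inf [set Num.sqrt #|T|%:R * l2norm (col_submx X T *m u)
             / (Num.sqrt n%:R * l1norm u)
       | u in [set u : 'cV[R]_#|T| | u != 0]].

(* The maximum of [nu X T] over [#|T| = k]; since [nu] is nonnegative, the
   default value 0 of the iterated maximum does not affect it when [k <= p]. *)
Definition nubar (R : realType) (n p : nat) (X : 'M[R]_(n, p)) (k : nat) : R :=
  \big[Num.max/0]_(T : {set 'I_p} | #|T| == k) nu X T.

Definition mutually_independent (R : realType) (d : measure_display)
    (Omega : measurableType d) (P : probability Omega R) (n : nat)
    (xi : 'I_n -> {RV P >-> R}) : Prop :=
  forall (J : {set 'I_n}) (A : 'I_n -> set R),
    (forall i, measurable (A i)) ->
    P (\bigcap_(i in [set` J]) (xi i @^-1` A i)) =
      (\prod_(i in J) P (xi i @^-1` A i))%E.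

(* The random vector [xi] has law N_n(0, sigma^2 I_n), i.e. the n-fold product
   of N(0, sigma^2); the second parameter of [normal_prob] is the standard
   deviation. *)
Definition gaussian_noise (R : realType) (d : measure_display)
    (Omega : measurableType d) (P : probability Omega R) (n : nat)
    (xi : 'I_n -> {RV P >-> R}) (sigma : R) : Prop :=
  mutually_independent xi /\
  forall (i : 'I_n) (A : set R), measurable A ->
    distribution P (xi i) A = normal_prob 0 sigma A.

(* "[E] holds with probability at least [a]". [P E] carries no information on a
   set [E] not known to be measurable, hence the measurable subset; for a
   measurable [E] this is [a <= P E], see [with_prob_geE]. *)
Definition with_prob_ge (R : realType) (d : measure_display)
    (Omega : measurableType d) (P : probability Omega R) (a : R)
    (E : set Omega) : Prop :=
  exists A : set Omega, [/\ measurable A, A `<=` E & (a%:E <= P A)%E].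

Lemma with_prob_geE (R : realType) (d : measure_display)
    (Omega : measurableType d) (P : probability Omega R) (a : R)
    (E : set Omega) :
  measurable E -> with_prob_ge P a E <-> (a%:E <= P E)%E.
Proof.
move=> mE; split=> [[A [mA AE]]|aE]; last by exists E; split.
by move=> /le_trans; apply; apply: le_measure; rewrite ?inE.
Qed.

(* Main.v *)
Require Import Defs.
From HB Require Import structures.
From mathcomp Require Import all_boot all_order all_algebra.
From mathcomp Require Import all_classical all_reals all_analysis.
From mathcomp Require Import measurable_realfun measurable_fun_approximation.
From mathcomp Require Import ring lra.

(** Write [z = X (betastar - betahat)] and [L] for its Euclidean length, so
    that the prediction loss is [L ^+ 2 / n].  Let [T] be a set of [r = \rank X]
    columns at which [nubar] is attained.  Its columns form a basis of the range
    of [X], hence [z = X v] for some [v] supported on [T], and the definition of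
    [nu] bounds the l1 norm of this [v] by a multiple of [L].  Comparing
    [betahat] with [betahat + t v] for small [t > 0], and not with [betastar]
    itself, uses only the triangle inequality for the l1 norm and gives
    [L ^+ 2 + <xi, z> <= n lambda |v|_1] ([lasso_first_order]).  In this
    inequality the noise acts only through its projection on the range of [X],
    that is through [Q xi] for an orthonormal basis [Q].  Two applications of
    Young's inequality, each absorbing a quarter of [L ^+ 2], then give
    [L ^+ 2 / n <= 2 lambda ^+ 2 r / nu ^+ 2 + 2 |Q xi| ^+ 2 / n]
    ([lasso_prediction_bound]).

    It remains to see that [|Q xi| ^+ 2 <= 2 sigma ^+ 2 (r + 2 ln (1 / delta))]
    with probability at least [1 - delta].  This is the Chernoff bound for a
    chi-square variable at the exponent 1/4: the exponential moment is
    [2 `^ (r / 2)], which is at most [expR (r / 2)].  The moment is computed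
    without any rotation invariance of the Gaussian law: each factor
    [expR (<q, xi> ^+ 2 / (4 sigma ^+ 2))] is written as the Gaussian integral
    over [g] of [expR (g <q, xi> / (sqrt 2 sigma))], and exchanging the
    integrals reduces everything to the moment generating function of [xi]
    ([gaussian_quadratic_mgf]), which is a product over the coordinates by
    independence ([mutually_independent_ge0_integral_prod]). *)

Set Implicit Arguments.
Unset Strict Implicit.
Unset Printing Implicit Defensive.

Import Order.TTheory GRing.Theory Num.Theory.
Local Open Scope classical_set_scope.
Local Open Scope ring_scope.

(** * Integration against a weighted image measure *)

Section weighted.
Import HBNNSimple.
Local Open Scope ereal_scope.

(** A change of variables for the image by [phi] of the measure of density [H].
    It is used twice: with [phi = idfun] and [H] a Gaussian density, and with
    [phi] a random variable and [H] a function of variables independent of it,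
    in which case [nu] is a multiple of the law of [phi]. *)
Lemma ge0_integral_weighted (R : realType) (d d' : measure_display)
    (T : measurableType d) (Y : measurableType d')
    (mu : {measure set T -> \bar R}) (nu : {measure set Y -> \bar R})
    (phi : T -> Y) (H : T -> R) (f : Y -> \bar R) :
  measurable_fun setT phi -> measurable_fun setT H ->
  (forall x, (0 <= H x)%R) ->
  (forall A : set Y, measurable A -> nu A = \int[mu]_(x in phi @^-1` A) (H x)%:E) ->
  measurable_fun setT f -> (forall y, 0 <= f y) ->
  \int[nu]_y f y = \int[mu]_x (f (phi x) * (H x)%:E).
Proof.
move=> mphi mH H0 nuE mf f0; pose h := nnsfun_approx measurableT mf.
have mhphi k : measurable_fun setT (fun x => h k (phi x)).
  exact: measurableT_comp.
have cvgh y : (h k y)%:E @[k --> \oo] --> f y by exact: cvg_nnsfun_approx.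
have ndh y a b : (a <= b)%N -> (h a y <= h b y)%R.
  by move=> ab; exact/lefP/nd_nnsfun_approx.
transitivity (lim (\int[nu]_y (h k y)%:E @[k --> \oo])).
  rewrite -monotone_convergence//=.
  - by apply: eq_integral => y _; apply/esym/cvg_lim.
  - by move=> k; exact/measurable_EFinP.
  - by move=> k y _; rewrite lee_fin.
  - by move=> y _ a b ab; rewrite lee_fin ndh.
transitivity (lim (\int[mu]_x ((h k (phi x))%:E * (H x)%:E) @[k --> \oo]));
    last first.
  rewrite -monotone_convergence//=.
  - by apply: eq_integral => x _; apply/cvg_lim => //; exact: cvgeZr.
  - by move=> k; apply: emeasurable_funM; exact/measurable_EFinP.
  - by move=> k y _; rewrite mule_ge0 ?lee_fin.
  - by move=> x _ a b ab; rewrite lee_wpmul2r ?lee_fin ?ndh.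
congr (limn _); apply/funext => k.
have mpre r : measurable (phi @^-1` (h k @^-1` [set r])).
  by rewrite -[X in measurable X]setTI; exact: mphi.
(* On a simple function both integrals are the same combination of level sets. *)
transitivity (\sum_(r \in range (h k))
    \int[nu]_y (r * \1_(h k @^-1` [set r]) y)%:E).
  under eq_integral do rewrite fimfunE -fsumEFin//.
  rewrite ge0_integral_fsum//.
  - by move=> y; exact/measurable_EFinP/measurable_funM.
  - by move=> y x _; rewrite nnfun_muleindic_ge0.
transitivity (\sum_(r \in range (h k))
    \int[mu]_x ((r * \1_(h k @^-1` [set r]) (phi x))%:E * (H x)%:E)); last first.
  rewrite -ge0_integral_fsum//.
  - apply: eq_integral => x _; rewrite -ge0_mule_fsuml; last first.
      by move=> y; rewrite nnfun_muleindic_ge0.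
    by rewrite fsumEFin// -fimfunE.
  - move=> y; apply: emeasurable_funM; apply/measurable_EFinP => //.
    by apply: measurable_funM => //; apply: measurableT_comp.
  - move=> y x _; apply: mule_ge0; last by rewrite lee_fin.
    exact: nnfun_muleindic_ge0.
apply: eq_fsbigr => r /[!inE] -[y _ <-].
rewrite integralZl_indic_nnsfun// integral_indic// setIT nuE//.
under [RHS]eq_integral do rewrite EFinM -muleA.
rewrite ge0_integralZl ?lee_fin//; last 2 first.
- apply: emeasurable_funM; apply/measurable_EFinP => //.
  by apply: measurableT_comp => //; apply: measurable_indic.
- by move=> x _; rewrite mule_ge0 ?lee_fin.
rewrite integral_mkcond; congr (_ * _); apply: eq_integral => x _.
rewrite /patch indicE; case: ifPn => xA.
  by rewrite (_ : _ \in _) ?mul1e// -in_preimage.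
rewrite (_ : (phi x \in _) = false) ?mul0e//; apply: negbTE.
by rewrite notin_setE => hx; rewrite notin_setE in xA; apply: xA.
Qed.
End weighted.

Lemma ge0_integral_normal_law (R : realType) (d : measure_display)
    (Omega : measurableType d) (P : probability Omega R) (X : {RV P >-> R})
    (m s : R) (f : R -> \bar R) :
  (forall A : set R, measurable A -> distribution P X A = normal_prob m s A) ->
  measurable_fun setT f -> (forall x, (0 <= f x)%E) ->
  (\int[P]_w f (X w) =
   \int[lebesgue_measure]_x (f x * (normal_pdf m s x)%:E))%E.
Proof.
move=> law mf f0; rewrite -(ge0_integral_distribution X mf f0).
rewrite (@ge0_integral_weighted R _ _ _ _ lebesgue_measure (distribution P X)
  idfun (normal_pdf m s) f) //.
- exact: measurable_id.
- exact: measurable_normal_pdf.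
- by move=> x; exact: normal_pdf_ge0.
Qed.

(** * Expectations of products of independent variables *)

Lemma integral_indic_preimage (R : realType) (d d' : measure_display)
    (T : measurableType d) (Y : measurableType d')
    (mu : {measure set T -> \bar R}) (phi : T -> Y) (A : set Y) :
  measurable A -> measurable_fun setT phi ->
  (\int[mu]_x (\1_A (phi x))%:E = mu (phi @^-1` A))%E.
Proof.
move=> mA mphi; have mpA : measurable (phi @^-1` A).
  by rewrite -[X in measurable X]setTI; exact: mphi.
by have := integral_indic mu measurableT mpA; rewrite setIT.
Qed.

(** When all the [f i] are indicator functions this is the definition of mutual
    independence.  The indicators are replaced by general functions one
    coordinate at a time: for fixed functions at the other coordinates,
    [A |-> E[\1_A (xi k) * H]] is a multiple of the law of [xi k], so the product
    rule passes from indicators to all nonnegative measurable functions of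
    [xi k]. *)
Lemma mutually_independent_ge0_integral_prod (R : realType)
    (d : measure_display) (Omega : measurableType d) (P : probability Omega R)
    (n : nat) (xi : 'I_n -> {RV P >-> R}) (f : 'I_n -> R -> R)
    (m : 'I_n -> R) :
  mutually_independent xi ->
  (forall i, measurable_fun setT (f i)) -> (forall i x, 0 <= f i x) ->
  (forall i, (\int[P]_w (f i (xi i w))%:E = (m i)%:E)%E) ->
  (\int[P]_w (\prod_i f i (xi i w))%:E = (\prod_i m i)%:E)%E.
Proof.
move=> ind.
(* The coordinates in [s] carry arbitrary functions, the others indicators. *)
suff H (s : seq 'I_n) : forall (f : 'I_n -> R -> R) (m : 'I_n -> R),
    (forall i, measurable_fun setT (f i)) -> (forall i x, 0 <= f i x) ->
    (forall i, (\int[P]_w (f i (xi i w))%:E = (m i)%:E)%E) ->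
    (forall i, i \notin s ->
       exists2 A : set R, measurable A & f i = (\1_A : R -> R)) ->
    (\int[P]_w (\prod_i f i (xi i w))%:E = (\prod_i m i)%:E)%E.
  by move=> mf f0 fm; apply: (H (enum 'I_n)) => // i; rewrite mem_enum.
move=> {f m}; elim: s => [|k s IH] f m mf f0 fm fs.
  have [A mA fA] : exists2 A : 'I_n -> set R, (forall i, measurable (A i)) &
      (forall i, f i = \1_(A i)).
    have /choice[A AP] : forall i, exists A : set R,
        measurable A /\ f i = (\1_A : R -> R).
      by move=> i; have [//|A] := fs i; exists A.
    by exists A => i; have [] := AP i.
  have mxA i : measurable (xi i @^-1` A i).
    by rewrite -[X in measurable X]setTI; exact: measurable_funPT.
  have mi i : (m i)%:E = P (xi i @^-1` A i).
    rewrite -fm; under eq_integral do rewrite fA.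
    exact: integral_indic_preimage.
  pose S := \bigcap_(i in [set` [set: 'I_n]%SET]) (xi i @^-1` A i).
  have mS : measurable S by apply: fin_bigcap_measurable.
  transitivity (P S); last first.
    rewrite /S ind// -prodEFin; apply: eq_big => [i|i _]; first by rewrite inE.
    exact/esym.
  rewrite -(integral_indic_preimage P mS (@measurable_id _ _ setT)).
  apply: eq_integral => w _; congr EFin.
  under eq_bigr do rewrite fA.
  rewrite indicE; have [wS|wS] := boolP (w \in S).
    rewrite big1// => i _; rewrite indicE mem_set//.
    by move: wS; rewrite inE => /(_ i) /=; apply; rewrite inE.
  have [i wi] : exists i, ~ A i (xi i w).
    move: wS; rewrite notin_setE => /existsNP[i] /not_implyP[_ wi].
    by exists i.
  by rewrite (bigD1 i)//= indicE memNset// mul0r.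
(* [H] collects the other coordinates and [C] is its expectation. *)
pose H w := \prod_(i | i != k) f i (xi i w).
pose C := \prod_(i | i != k) m i.
have m0 i : 0 <= m i.
  by rewrite -lee_fin -fm integral_ge0// => w _; rewrite lee_fin.
have C0 : 0 <= C by exact: prodr_ge0.
have mfx i : measurable_fun setT (fun w => f i (xi i w)).
  exact: measurableT_comp.
have mH : measurable_fun setT H.
  rewrite /H; under eq_fun do rewrite -big_filter.
  exact: measurable_prod.
have H0 w : 0 <= H w by exact: prodr_ge0.
under eq_integral do rewrite (bigD1 k)//= EFinM.
rewrite (bigD1 k)//= -/C.
rewrite -(@ge0_integral_weighted _ _ _ _ _ P
  (mscale (NngNum C0) (distribution P (xi k))) (xi k) H (EFin \o f k)) //=.
- rewrite ge0_integral_mscale//=; last 2 first.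
  + exact/measurable_EFinP.
  + by move=> x _; rewrite lee_fin.
  rewrite ge0_integral_distribution//=; last 2 first.
  + exact/measurable_EFinP.
  + by move=> x; rewrite lee_fin.
  by rewrite fm -EFinM mulrC.
- move=> A mA; rewrite /mscale/= /distribution /pushforward.
  pose f' i := if i == k then (\1_A : R -> R) else f i.
  pose m' i := if i == k then fine (P (xi k @^-1` A)) else m i.
  have mxA : measurable (xi k @^-1` A).
    by rewrite -[X in measurable X]setTI; exact: measurable_funPT.
  have IH' : (\int[P]_w (\prod_i f' i (xi i w))%:E = (\prod_i m' i)%:E)%E.
    apply: IH.
    + by move=> i; rewrite /f'; case: ifP => // _; exact: measurable_indic.
    + by move=> i x; rewrite /f'; case: ifP.
    + move=> i; rewrite /f' /m'; case: ifPn => [/eqP ->|ik]; last exact: fm.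
      by rewrite integral_indic_preimage// fineK// fin_num_measure.
    + move=> i; rewrite /f'; case: eqVneq => [_ _|ik]; first by exists A.
      by move=> si; apply: fs; rewrite inE negb_or ik.
  transitivity (\int[P]_w (\prod_i f' i (xi i w))%:E)%E.
    rewrite IH' (bigD1 k)//= {1}/m' eqxx (eq_bigr m); last first.
      by move=> i /negbTE; rewrite /m' => ->.
    by rewrite EFinM fineK ?fin_num_measure// muleC.
  rewrite [RHS]integral_mkcond; apply: eq_integral => w _.
  rewrite /patch (bigD1 k)//= {1}/f' eqxx indicE.
  rewrite (eq_bigr (fun i => f i (xi i w))); last first.
    by move=> i /negbTE; rewrite /f' => ->.
  rewrite -/(H w); case: ifPn => wA.
    by rewrite mem_set ?mul1r//; move: wA; rewrite inE.
  by rewrite memNset ?mul0r//; move: wA; rewrite notin_setE.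
- exact/measurable_EFinP.
- by move=> y; rewrite lee_fin.
Qed.

(** * Exponential moments of Gaussian variables *)

Lemma integral_scaled_normal_pdf (R : realType) (C m s : R) (f : R -> R) :
  0 <= C -> (forall x, f x = C * normal_pdf m s x) ->
  (\int[lebesgue_measure]_x (f x)%:E = C%:E)%E.
Proof.
move=> C0 fE; under eq_integral do rewrite fE EFinM.
have mpdf : measurable_fun [set: R] (fun x => (normal_pdf m s x)%:E).
  by apply/measurable_EFinP => /=; apply: measurable_normal_pdf.
rewrite ge0_integralZl//; last first.
  by move=> x _; rewrite lee_fin normal_pdf_ge0.
by rewrite integral_normal_pdf mule1.
Qed.

(** Completing the square turns the integrand into [expR (s ^+ 2 / 2 * c ^+ 2)]
    times the density of mean [s ^+ 2 * c] and standard deviation [s]. *)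
Lemma integral_expR_normal_pdf (R : realType) (s c : R) : s != 0 ->
  (\int[lebesgue_measure]_x (expR (c * x) * normal_pdf 0 s x)%:E =
   (expR (s ^+ 2 / 2 * c ^+ 2))%:E)%E.
Proof.
move=> s0; apply: (@integral_scaled_normal_pdf _ _ (s ^+ 2 * c) s).
  exact: expR_ge0.
move=> x; rewrite !normal_pdfE// /normal_fun mulrCA -expRD [RHS]mulrCA -expRD.
by congr (_ * expR _); field.
Qed.

(** The exponent [x ^+ 2 / 4 - x ^+ 2 / 2] has half the curvature of the standard
    one: the standard deviation becomes [sqrt 2], whence the constant. *)
Lemma integral_expR_sqr_normal_pdf (R : realType) (a : R) :
  (\int[lebesgue_measure]_x (expR (x ^+ 2 / 4 + a * x) * normal_pdf 0 1 x)%:E =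
   (Num.sqrt 2 * expR (a ^+ 2))%:E)%E.
Proof.
apply: (@integral_scaled_normal_pdf _ _ (2 * a) (Num.sqrt 2)).
  by rewrite mulr_ge0 ?expR_ge0.
have s20 : Num.sqrt 2 != 0 :> R by rewrite gt_eqF// sqrtr_gt0.
have s22 : Num.sqrt 2 ^+ 2 = 2 :> R by rewrite sqr_sqrtr.
have pk : normal_peak 1 = Num.sqrt 2 * normal_peak (Num.sqrt 2) :> R.
  rewrite /normal_peak s22 expr1n mul1r -[in RHS]mulrnAr sqrtrM// invfM.
  by rewrite mulrA divff// mul1r.
move=> x; rewrite !normal_pdfE ?oner_eq0// pk /normal_fun s22.
rewrite mulrCA -expRD [RHS]mulrACA -expRD.
by congr (_ * expR _); field.
Qed.

Lemma gaussian_noise_mgf (R : realType) (d : measure_display)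
    (Omega : measurableType d) (P : probability Omega R) (n : nat)
    (xi : 'I_n -> {RV P >-> R}) (sigma : R) (c : 'I_n -> R) :
  0 < sigma -> gaussian_noise xi sigma ->
  (\int[P]_w (expR (\sum_i c i * xi i w))%:E =
   (expR (sigma ^+ 2 / 2 * \sum_i c i ^+ 2))%:E)%E.
Proof.
move=> s0 [ind law]; rewrite mulr_sumr expR_sum.
under eq_integral do rewrite expR_sum.
have mexp a : measurable_fun [set: R] (fun x : R => expR (a * x)).
  by apply: measurableT_comp => //; exact: mulrl_measurable.
apply: (mutually_independent_ge0_integral_prod (f := fun i x => expR (c i * x))).
- exact: ind.
- by move=> i; exact: mexp.
- by move=> i x; exact: expR_ge0.
move=> i; rewrite (ge0_integral_normal_law (f := fun x => (expR (c i * x))%:E)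
  (law i)); last 2 first.
- exact/measurable_EFinP.
- by move=> x; rewrite lee_fin expR_ge0.
by rewrite -(@integral_expR_normal_pdf _ sigma (c i))// gt_eqF.
Qed.

(** * The Euclidean inner product *)

Definition dot (R : realType) (m : nat) (u v : 'cV[R]_m) : R :=
  \sum_i u i ord0 * v i ord0.

Section dot_theory.
Variables (R : realType) (m : nat).
Implicit Types (u v w : 'cV[R]_m) (a : R).

Lemma dotC u v : dot u v = dot v u.
Proof. by apply: eq_bigr => i _; rewrite mulrC. Qed.

Lemma dotDl u v w : dot (u + v) w = dot u w + dot v w.
Proof. by rewrite -big_split; apply: eq_bigr => i _; rewrite mxE mulrDl. Qed.

Lemma dotZl a u v : dot (a *: u) v = a * dot u v.
Proof. by rewrite mulr_sumr; apply: eq_bigr => i _; rewrite mxE mulrA. Qed.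

Lemma dotNl u v : dot (- u) v = - dot u v.
Proof. by rewrite -scaleN1r dotZl mulN1r. Qed.

Lemma dotDr u v w : dot u (v + w) = dot u v + dot u w.
Proof. by rewrite dotC dotDl !(dotC u). Qed.

Lemma dotZr a u v : dot u (a *: v) = a * dot u v.
Proof. by rewrite dotC dotZl (dotC u). Qed.

Lemma dotNr u v : dot u (- v) = - dot u v.
Proof. by rewrite dotC dotNl (dotC u). Qed.

Lemma dot_ge0 u : 0 <= dot u u.
Proof. by apply: sumr_ge0 => i _; rewrite -expr2 sqr_ge0. Qed.

Lemma dot_eq0 u : (dot u u == 0) = (u == 0).
Proof.
apply/eqP/eqP => [|->]; last by apply: big1 => i _; rewrite !mxE mul0r.
move=> /psumr_eq0P u0; apply/colP => i; rewrite mxE.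
have /eqP : u i ord0 * u i ord0 = 0.
  by apply: u0 => // j _; rewrite -expr2 sqr_ge0.
by rewrite mulf_eq0 orbb => /eqP.
Qed.

Lemma dotE u v : dot u v = (u^T *m v) ord0 ord0.
Proof. by rewrite mxE; apply: eq_bigr => i _; rewrite mxE. Qed.

Lemma l2norm_sqr u : l2norm u ^+ 2 = dot u u.
Proof.
rewrite /l2norm sqr_sqrtr; last by apply: sumr_ge0 => i _; exact: sqr_ge0.
by apply: eq_bigr => i _; rewrite expr2.
Qed.

End dot_theory.

Lemma dot_mulmx (R : realType) (m k : nat) (A : 'M[R]_(m, k)) (u : 'cV[R]_m)
    (v : 'cV[R]_k) : dot u (A *m v) = dot (A^T *m u) v.
Proof. by rewrite !dotE trmx_mul trmxK mulmxA. Qed.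

(** * The squared length of a projected Gaussian vector *)

(** The noise enters only through its moment generating function.  The linear
    term [dot c (Z w)] is what makes the induction on [s] go through: writing
    [expR (x ^+ 2 / 2)] as the integral of [expR (g * x)] against the standard
    Gaussian density in [g], with [x = dot (q k) (Z w) / (sqrt 2 * sigma)],
    trades the square along [q k] for a shift of [c] by a multiple of [q k],
    which leaves the [dot (q j) c] for the other [j] unchanged. *)
Lemma gaussian_quadratic_mgf (R : realType) (d : measure_display)
    (Omega : measurableType d) (P : probability Omega R) (n : nat)
    (Z : Omega -> 'cV[R]_n) (sigma : R) (I : eqType) (q : I -> 'cV[R]_n)
    (s : seq I) (c : 'cV[R]_n) :
  0 < sigma ->
  (forall b, measurable_fun setT (fun w => dot b (Z w))) ->
  (forall b, \int[P]_w (expR (dot b (Z w)))%:E =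
             (expR (sigma ^+ 2 / 2 * dot b b))%:E)%E ->
  (forall i j, dot (q i) (q j) = (i == j)%:R) -> uniq s ->
  (\int[P]_w (expR (\sum_(j <- s) dot (q j) (Z w) ^+ 2 / (4 * sigma ^+ 2)
                    + dot c (Z w)))%:E =
   (Num.sqrt 2 ^+ size s *
    expR (sigma ^+ 2 / 2 * (dot c c + \sum_(j <- s) dot (q j) c ^+ 2)))%:E)%E.
Proof.
move=> s0 mZ mgfZ orth; elim: s c => [c _|k s IH c /= /andP[ks us]].
  rewrite big_nil addr0 expr0 mul1r -mgfZ.
  by apply: eq_integral => w _; rewrite big_nil add0r.
have s20 : Num.sqrt 2 != 0 :> R by rewrite gt_eqF// sqrtr_gt0.
have sn0 : sigma != 0 by rewrite gt_eqF.
have s22 : Num.sqrt 2 ^+ 2 = 2 :> R by rewrite sqr_sqrtr.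
pose t : R := (Num.sqrt 2 * sigma)^-1.
pose Sq w := \sum_(j <- s) dot (q j) (Z w) ^+ 2 / (4 * sigma ^+ 2).
have mSq : measurable_fun setT Sq.
  apply: measurable_sum => j; apply: measurable_funM => //.
  exact: (measurableT_comp (exprn_measurable 2) (mZ (q j))).
pose f (x : Omega * measurableTypeR R) : \bar R :=
  (expR (Sq x.1 + dot (c + (t * x.2) *: q k) (Z x.1)) * normal_pdf 0 1 x.2)%:E.
have mf : measurable_fun setT f.
  apply/measurable_EFinP; apply: measurable_funM; last first.
    apply: (measurableT_comp (f := normal_pdf 0 1)) => //.
    exact: measurable_normal_pdf.
  apply: measurableT_comp => //; apply: measurable_funD.
    exact: (measurableT_comp mSq).
  under eq_fun do rewrite dotDl dotZl.
  apply: measurable_funD; first exact: (measurableT_comp (mZ c)).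
  apply: measurable_funM; last exact: (measurableT_comp (mZ (q k))).
  by apply: measurable_funM => //; exact: measurable_cst.
have f0 x : (0 <= f x)%E by rewrite lee_fin mulr_ge0 ?expR_ge0 ?normal_pdf_ge0.
transitivity (\int[P]_w \int[lebesgue_measure]_g f (w, g))%E.
  apply: eq_integral => w _.
  rewrite big_cons -/(Sq w) -addrA expRD EFinM.
  rewrite (_ : _ / _ = 1 ^+ 2 / 2 * (t * dot (q k) (Z w)) ^+ 2); last first.
    by rewrite /t !invfM !exprMn !exprVn s22; field.
  rewrite -integral_expR_normal_pdf ?oner_eq0// muleC -ge0_integralZl//=.
  - apply: eq_integral => g _; rewrite /f/= -EFinM mulrA -expRD dotDl dotZl.
    by congr (expR _ * _)%:E; ring.
  - apply/measurable_EFinP; apply: measurable_funM; last first.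
      exact: measurable_normal_pdf.
    by apply: measurableT_comp => //; exact: mulrl_measurable.
  - by move=> g _; rewrite lee_fin mulr_ge0 ?expR_ge0 ?normal_pdf_ge0.
(* Tonelli; the inner integral over [w] is then the induction hypothesis. *)
rewrite fubini_tonelli//.
pose B := dot c c + \sum_(j <- s) dot (q j) c ^+ 2.
transitivity (\int[lebesgue_measure]_g
   ((Num.sqrt 2 ^+ size s * expR (sigma ^+ 2 / 2 * B))%:E *
    (expR (g ^+ 2 / 4 + (sigma / Num.sqrt 2 * dot (q k) c) * g) *
     normal_pdf 0 1 g)%:E))%E.
  apply: eq_integral => g _; rewrite /f/=.
  under eq_integral do rewrite EFinM.
  rewrite ge0_integralZr ?lee_fin ?normal_pdf_ge0//; last first.
    apply/measurable_EFinP; apply: measurableT_comp => //.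
    exact: measurable_funD.
  rewrite IH// -!EFinM; congr EFin; rewrite mulrA; congr (_ * _).
  rewrite -[RHS]mulrA -expRD; congr (_ * expR _).
  rewrite (eq_big_seq (fun j => dot (q j) c ^+ 2)); last first.
    move=> j js; rewrite dotDr dotZr orth (_ : j == k = false) ?mulr0 ?addr0//.
    by apply: contraNF ks => /eqP <-.
  rewrite dotDl !dotDr !dotZl !dotZr orth eqxx (dotC c (q k)).
  have tE : sigma * t = (Num.sqrt 2)^-1 by rewrite /t invfM mulrCA mulfV ?mulr1.
  have t2 : (sigma * t) ^+ 2 = 2^-1 by rewrite tE exprVn s22.
  transitivity (sigma ^+ 2 / 2 * B + ((sigma * t) ^+ 2 / 2 * g ^+ 2
      + sigma * (sigma * t) * dot (q k) c * g)); first by rewrite /B mulr1n; field.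
  by rewrite t2 tE; congr (_ + (_ + _)); field.
rewrite ge0_integralZl//=.
- rewrite integral_expR_sqr_normal_pdf -EFinM; congr EFin.
  rewrite big_cons mulrACA -expRD -exprSr.
  by congr (_ * expR _); rewrite /B !exprMn !exprVn s22; field.
- apply/measurable_EFinP; apply: measurable_funM; last first.
    exact: measurable_normal_pdf.
  apply: measurableT_comp => //; apply: measurable_funD.
    apply: measurable_funM => //; exact: exprn_measurable.
  exact: mulrl_measurable.
- by move=> g _; rewrite lee_fin mulr_ge0 ?expR_ge0 ?normal_pdf_ge0.
Qed.

(** Chernoff's bound at the exponent [1 / (4 * sigma ^+ 2)], where the exponential
    moment [sqrt 2 ^+ r] is at most [expR (r / 2)] since [2 <= expR 1]. *)
Lemma orthonormal_projection_tail (R : realType) (d : measure_display)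
    (Omega : measurableType d) (P : probability Omega R) (n r : nat)
    (xi : 'I_n -> {RV P >-> R}) (sigma : R) (Q : 'M[R]_(r, n)) (delta : R) :
  0 < sigma -> gaussian_noise xi sigma -> Q *m Q^T = 1%:M ->
  0 < delta ->
  with_prob_ge P (1 - delta)
    [set w | dot (Q *m \col_i xi i w) (Q *m \col_i xi i w) <=
             2 * sigma ^+ 2 * (r%:R + 2 * ln (1 / delta))].
Proof.
move=> s0 gauss QQ d0.
pose Z w : 'cV[R]_n := \col_i xi i w.
have ZE b w : dot b (Z w) = \sum_i b i ord0 * xi i w.
  by apply: eq_bigr => i _; rewrite mxE.
have mZ b : measurable_fun setT (fun w => dot b (Z w)).
  under eq_fun do rewrite ZE.
  by apply: measurable_sum => i; exact: measurable_funM.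
have mgfZ b : (\int[P]_w (expR (dot b (Z w)))%:E =
    (expR (sigma ^+ 2 / 2 * dot b b))%:E)%E.
  under eq_integral do rewrite ZE.
  rewrite (gaussian_noise_mgf (fun i => b i ord0) s0 gauss).
  by congr (expR (_ * _))%:E; apply: eq_bigr => i _; rewrite expr2.
pose q j : 'cV[R]_n := (row j Q)^T.
have qE j w : dot (q j) (Z w) = (Q *m Z w) j ord0.
  by rewrite mxE; apply: eq_bigr => i _; rewrite !mxE.
have orth i j : dot (q i) (q j) = (i == j)%:R.
  have /matrixP/(_ i j) := QQ; rewrite mxE [in RHS]mxE => <-.
  by apply: eq_bigr => l _; rewrite !mxE.
pose X w := \sum_(j <- enum 'I_r) dot (q j) (Z w) ^+ 2 / (4 * sigma ^+ 2).
have mX : measurable_fun setT X.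
  apply: measurable_sum => j; apply: measurable_funM => //.
  exact: (measurableT_comp (exprn_measurable 2) (mZ (q j))).
have XE w : X w = dot (Q *m Z w) (Q *m Z w) / (4 * sigma ^+ 2).
  by rewrite /X big_enum mulr_suml; apply: eq_bigr => j _; rewrite qE expr2.
have EX : (\int[P]_w (expR (X w))%:E = (Num.sqrt 2 ^+ r)%:E)%E.
  have := gaussian_quadratic_mgf 0 s0 mZ mgfZ orth (enum_uniq 'I_r).
  have z0 (u : 'cV[R]_n) : dot u 0 = 0.
    by apply: big1 => i _; rewrite mxE mulr0.
  have z0' (u : 'cV[R]_n) : dot 0 u = 0 by rewrite dotC.
  rewrite z0 big1; last by move=> j _; rewrite z0 expr0n.
  rewrite addr0 mulr0 expR0 mulr1 size_enum_ord => <-.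
  by apply: eq_integral => w _; rewrite z0' addr0.
pose b := r%:R / 2 + ln (1 / delta).
pose A := [set w | X w <= b].
have mA : measurable A.
  rewrite -[A]setTI; exact: measurable_fun_le.
exists A; split=> // [w|].
  rewrite /A/= XE ler_pdivrMr ?mulr_gt0 ?exprn_gt0// => /le_trans; apply.
  by rewrite /b; lra.
have [mAc bound] : measurable (~` A) /\ (P (~` A) <= delta%:E)%E.
  split; first exact: measurableC.
  have mexpX : measurable_fun setT (fun w => (expR (X w))%:E).
    by apply/measurable_EFinP; exact: measurableT_comp.
  have := le_integral_abse P measurableT mexpX (expR_gt0 b).
  under eq_integral do rewrite gee0_abs ?lee_fin ?expR_ge0//.
  rewrite EX setTI; set S := [set _ | _] => H.
  have mS : measurable S.
    rewrite -[S]setTI; apply: emeasurable_fun_c_infty => //.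
    exact: measurableT_comp.
  have {H} : ((expR b)%:E * P (~` A) <= (Num.sqrt 2 ^+ r)%:E)%E.
    apply: le_trans H; rewrite lee_pmul2l ?lte_fin ?expR_gt0//.
    apply: le_measure; rewrite ?inE//; first exact: measurableC.
    move=> w /negP; rewrite -ltNge => /ltW bX; rewrite /S/=.
    by rewrite ger0_norm ?expR_ge0// lee_fin ler_expR.
  rewrite -(@fineK _ (P (~` A))) ?fin_num_measure//; last exact: measurableC.
  rewrite -EFinM !lee_fin mulrC -ler_pdivlMr ?expR_gt0// => /le_trans; apply.
  rewrite ler_pdivrMr ?expR_gt0// /b expRD lnK ?posrE ?divr_gt0//.
  rewrite mul1r mulrCA divff ?gt_eqF// mulr1.
  rewrite expRM_natl lerXn2r ?nnegrE ?expR_ge0//.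
  rewrite -ler_sqr ?nnegrE ?expR_ge0// sqr_sqrtr//.
  by rewrite -expRM_natl mulfV//; exact: expR_ge1Dx.
rewrite -[A]setCK probability_setC//.
by rewrite EFinB leeB.
Qed.

(** * Orthonormal bases of row spaces *)

(** Gram-Schmidt: the first row is orthogonalized against an orthonormal basis
    of the span of the others, and freeness keeps the difference [b] nonzero. *)
Lemma orthonormal_rows_of_row_free (R : realType) (n k : nat) (A : 'M[R]_(k, n)) :
  row_free A ->
  exists2 Q : 'M[R]_(k, n), Q *m Q^T = 1%:M & (A <= Q)%MS.
Proof.
elim: k A => [|k IH] A.
  exists 0; first by apply/matrixP => -[].
  by rewrite [A]flatmx0 sub0mx.
rewrite -[k.+1]/(1 + k)%N in A * => Afree.
pose a := usubmx A; pose A' := dsubmx A.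
have AE : A = col_mx a A' by rewrite vsubmxK.
have A'free : row_free A'.
  apply/inj_row_free => v vA'.
  have /row_freeP[B AB] := Afree.
  have : row_mx 0 v *m A = 0 by rewrite AE mul_row_col mul0mx add0r.
  move=> /(congr1 (fun M => M *m B)); rewrite -mulmxA AB mulmx1 mul0mx.
  by rewrite -row_mx0 => /eq_row_mx[].
have [Q' QQ' A'Q'] := IH _ A'free.
pose b := a - a *m Q'^T *m Q'.
have bQ' : b *m Q'^T = 0 by rewrite mulmxBl -!mulmxA QQ' mulmx1 subrr.
have b0 : b != 0.
  apply/eqP => b0.
  have aQ' : (a <= Q')%MS.
    by have /eqP := b0; rewrite subr_eq0 => /eqP ->; exact: submxMl.
  have : (A <= Q')%MS by rewrite AE col_mx_sub aQ'.
  move=> /mxrankS; move: Afree; rewrite /row_free => /eqP ->.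
  by move=> /leq_trans/(_ (rank_leq_row _)); rewrite ltnn.
pose s := dot b^T b^T.
have s0 : 0 < s.
  by rewrite lt_neqAle dot_ge0 andbT eq_sym dot_eq0 -trmx0 (inj_eq (@trmx_inj _ _ _)).
have bb : b *m b^T = s%:M.
  by rewrite [LHS]mx11_scalar; congr (_%:M); rewrite /s dotE trmxK.
pose e := (Num.sqrt s)^-1 *: b.
exists (col_mx e Q').
  rewrite tr_col_mx mul_col_row QQ' /e linearZ/= -!scalemxAl -!scalemxAr bQ' bb.
  have -> : Q' *m b^T = 0 by apply: trmx_inj; rewrite trmx_mul trmxK bQ' trmx0.
  rewrite !scaler0 !scale_scalar_mx.
  rewrite (_ : _ * _ = 1) -?scalar_mx_block//.
  by rewrite mulrA -invfM -expr2 sqr_sqrtr ?ltW// mulVf ?gt_eqF.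
have eQ : (e <= col_mx e Q')%MS by rewrite -addsmxE addsmxSl.
have Q'Q : (Q' <= col_mx e Q')%MS by rewrite -addsmxE addsmxSr.
rewrite AE col_mx_sub (submx_trans A'Q' Q'Q) andbT.
have -> : a = Num.sqrt s *: e + a *m Q'^T *m Q'.
  by rewrite scalerA mulfV ?gt_eqF ?sqrtr_gt0// scale1r subrK.
apply: addmx_sub; first exact: scalemx_sub.
apply: submx_trans Q'Q; exact: submxMl.
Qed.

Lemma orthonormal_rows (R : realType) (m n : nat) (A : 'M[R]_(m, n)) :
  exists2 Q : 'M[R]_(\rank A, n), Q *m Q^T = 1%:M & (A <= Q)%MS.
Proof.
have [Q QQ AQ] := orthonormal_rows_of_row_free (row_base_free A).
by exists Q => //; rewrite -(eq_row_base A).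
Qed.

(** For [z] in the span of the rows of [Q], passing to coordinates loses nothing
    in a product with an arbitrary [u]: the part of [u] orthogonal to the span
    does not contribute. *)
Lemma dot_orthonormal (R : realType) (r n : nat) (Q : 'M[R]_(r, n))
    (u z : 'cV[R]_n) :
  Q *m Q^T = 1%:M -> (z^T <= Q)%MS -> dot (Q *m u) (Q *m z) = dot u z.
Proof.
move=> QQ /submxP[D zD].
have -> : z = Q^T *m D^T by rewrite -trmx_mul -zD trmxK.
by rewrite mulmxA QQ mul1mx dot_mulmx trmxK.
Qed.

(** * Norm inequalities *)

Section l1norm_theory.
Variables (R : realType) (m : nat).
Implicit Types (u v : 'cV[R]_m) (a : R).

Lemma l1norm_ge0 u : 0 <= l1norm u.
Proof. exact: sumr_ge0. Qed.

Lemma l1norm_eq0 u : (l1norm u == 0) = (u == 0).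
Proof.
apply/eqP/eqP => [|->]; last by apply: big1 => i _; rewrite mxE normr0.
move=> /psumr_eq0P u0; apply/colP => i; rewrite mxE.
by apply/eqP; rewrite -normr_eq0 u0.
Qed.

Lemma l1normD u v : l1norm (u + v) <= l1norm u + l1norm v.
Proof.
by rewrite -big_split; apply: ler_sum => i _; rewrite mxE; exact: ler_normD.
Qed.

Lemma l1normZ a u : l1norm (a *: u) = `|a| * l1norm u.
Proof. by rewrite mulr_sumr; apply: eq_bigr => i _; rewrite mxE normrM. Qed.

Lemma ler_coord_l2norm u i : `|u i ord0| <= l2norm u.
Proof.
rewrite -sqrtr_sqr ler_wsqrtr// (bigD1 i)//= lerDl.
by apply: sumr_ge0 => j _; exact: sqr_ge0.
Qed.

Lemma l2norm_eq0 u : (l2norm u == 0) = (u == 0).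
Proof. by rewrite -dot_eq0 -l2norm_sqr sqrf_eq0. Qed.

End l1norm_theory.

Lemma l1norm_mulmx (R : realType) (k m : nat) (L : 'M[R]_(k, m))
    (z : 'cV[R]_m) :
  l1norm (L *m z) <= (\sum_i \sum_j `|L i j|) * l2norm z.
Proof.
rewrite mulr_suml; apply: ler_sum => i _; rewrite mxE mulr_suml.
apply: le_trans (ler_norm_sum _ _ _) _; apply: ler_sum => j _.
by rewrite normrM ler_wpM2l// ler_coord_l2norm.
Qed.

(** * Optimality of a Lasso solution *)

Lemma dot_subZ (R : realType) (m : nat) (e z : 'cV[R]_m) (t : R) :
  dot (e - t *: z) (e - t *: z) =
  dot e e - 2 * t * dot e z + t ^+ 2 * dot z z.
Proof. by rewrite !(dotDl, dotDr, dotNl, dotNr, dotZl, dotZr) (dotC z e); ring. Qed.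

(** The objective at [b + t *: v] exceeds its value at [b] by at most
    [- t * dot (y - X b) (X v) / n + t * lambda * |v|_1] plus a term of order
    [t ^+ 2]; dividing by [t] and letting it tend to 0 gives the claim. *)
Lemma lasso_first_order (R : realType) (n p : nat) (X : 'M[R]_(n, p))
    (y : 'cV[R]_n) (lambda : R) (b v : 'cV[R]_p) :
  (0 < n)%N -> 0 <= lambda -> lasso_solution X y lambda b ->
  dot (y - X *m b) (X *m v) <= n%:R * lambda * l1norm v.
Proof.
move=> n0 lam0 sol; apply/ler_addgt0Pr => eps eps0.
have N0 : 0 < n%:R :> R by rewrite ltr0n.
set e := y - X *m b; set z := X *m v.
(* With this step the second-order term contributes at most [eps]. *)
pose t := eps / (dot z z + 1).
have B0 := dot_ge0 z.
have t0 : 0 < t by rewrite divr_gt0// ltr_wpDl.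
have tB : t * dot z z <= eps.
  by rewrite /t mulrAC ler_pdivrMr ?ltr_wpDl// ler_wpM2l ?(ltW eps0)// lerDl.
have := sol (b + t *: v).
rewrite /lasso_objective !l2norm_sqr mulmxDr opprD addrA -/e.
rewrite -scalemxAr -/z dot_subZ.
have := l1normD b (t *: v); rewrite l1normZ gtr0_norm//.
move=> /(ler_wpM2l lam0) h1 h2.
have {h1}h2 := le_trans h2 (lerD (lexx _) h1).
have {h2} : (2 * n%:R)^-1 * (t * (2 * dot e z)) <=
    (2 * n%:R)^-1 * (t * (t * dot z z + 2 * (n%:R * lambda * l1norm v))).
  rewrite -subr_ge0; move: h2; rewrite -subr_ge0; congr (0 <= _).
  by field; rewrite gt_eqF.
rewrite ler_pM2l ?invr_gt0 ?mulr_gt0// ler_pM2l// => h.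
lra.
Qed.

(** * The compatibility constants *)

Section nu_theory.
Variables (R : realType) (n p : nat) (X : 'M[R]_(n, p)).
Hypothesis n0 : (0 < n)%N.
Let sN0 : 0 < Num.sqrt n%:R :> R. Proof. by rewrite sqrtr_gt0 ltr0n. Qed.

Lemma nu_le (T : {set 'I_p}) (u : 'cV[R]_#|T|) :
  nu X T * (Num.sqrt n%:R * l1norm u) <=
  Num.sqrt #|T|%:R * l2norm (col_submx X T *m u).
Proof.
have [->|u0] := eqVneq u 0.
  rewrite (_ : l1norm 0 = 0) ?mulr0 ?mulr_ge0 ?sqrtr_ge0//.
  by apply/eqP; rewrite l1norm_eq0.
have u1 : 0 < l1norm u by rewrite lt_neqAle l1norm_ge0 eq_sym l1norm_eq0 u0.
rewrite -ler_pdivlMr ?mulr_gt0//; apply: ge_inf; last by exists u.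
exists 0 => _ [v v0 <-].
by rewrite divr_ge0 ?mulr_ge0 ?sqrtr_ge0 ?l1norm_ge0.
Qed.

(** A left inverse [L] of the submatrix bounds [|u|_1] by a multiple of the
    Euclidean norm of the image of [u]. *)
Lemma nu_gt0 (T : {set 'I_p}) :
  (0 < #|T|)%N -> row_free (col_submx X T)^T -> 0 < nu X T.
Proof.
move=> T0 /row_freeP[B BE].
have {BE} LX : B^T *m col_submx X T = 1%:M.
  by rewrite -[RHS]trmx1 -BE trmx_mul trmxK.
set L := B^T in LX.
(* The summand 1 only serves to make [K] positive. *)
pose K := \sum_i \sum_j `|L i j| + 1.
have K0 : 0 < K.
  by rewrite ltr_wpDl// sumr_ge0// => i _; rewrite sumr_ge0.
have T0' : 0 < Num.sqrt #|T|%:R :> R by rewrite sqrtr_gt0 ltr0n.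
apply: (@lt_le_trans _ _ (Num.sqrt #|T|%:R / (Num.sqrt n%:R * K))).
  by rewrite divr_gt0// mulr_gt0.
apply: lb_le_inf.
  set u0 : 'cV[R]_#|T| := const_mx 1.
  eexists; exists u0 => //=; apply/eqP => /colP/(_ (Ordinal T0)).
  by rewrite !mxE => /eqP; rewrite oner_eq0.
move=> _ [u /= u0 <-].
have u1 : 0 < l1norm u by rewrite lt_neqAle l1norm_ge0 eq_sym l1norm_eq0 u0.
rewrite ler_pdivrMr ?mulr_gt0// mulrAC ler_pdivlMr ?mulr_gt0//.
rewrite -!mulrA ler_pM2l// mulrCA ler_pM2l//.
rewrite -[in leLHS](mul1mx u) -LX -mulmxA mulrC.
apply: le_trans (l1norm_mulmx _ _) _.
by rewrite ler_wpM2r ?sqrtr_ge0// lerDl.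
Qed.

Lemma nu_gt0_row_free (T : {set 'I_p}) :
  0 < nu X T -> row_free (col_submx X T)^T.
Proof.
move=> nu0; apply: inj_row_free => v vX.
have Xv : col_submx X T *m v^T = 0 by rewrite -[LHS]trmxK trmx_mul trmxK vX trmx0.
have := nu_le v^T; rewrite Xv.
rewrite (_ : l2norm 0 = 0) ?mulr0; last by apply/eqP; rewrite l2norm_eq0.
rewrite pmulr_rle0// pmulr_rle0// => v0.
have : l1norm v^T == 0 by rewrite eq_le v0 l1norm_ge0.
by rewrite l1norm_eq0 => /eqP v0'; rewrite -[v]trmxK v0' trmx0.
Qed.

(** Some [\rank X] columns of [X] are linearly independent, so [nubar] is
    positive; the iterated maximum is then attained at a set of columns, and not
    at its default value 0. *)
Lemma nubar_attained : X != 0 ->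
  exists T : {set 'I_p}, [/\ #|T| = \rank X, 0 < nu X T &
                             nubar X (\rank X) = nu X T].
Proof.
move=> X0.
have r0 : (0 < \rank X)%N by rewrite lt0n mxrank_eq0.
pose A := X^T; pose f := maxrankfun A.
have rA : \rank A = \rank X by rewrite mxrank_tr.
pose T := [set f i | i : 'I_(\rank A)]%SET.
have cT : #|T| = \rank X.
  by rewrite card_imset ?card_ord//; exact: maxrankfun_inj.
have fT i : f i \in T by rewrite imset_f.
have nuT : 0 < nu X T.
  apply: nu_gt0; first by rewrite cT.
  rewrite /row_free eqn_leq rank_leq_row/=.
  apply: (@leq_trans (\rank A)); first by rewrite cT rA.
  rewrite /col_submx trmx_mxsub -/A -{1}(eq_maxrowsub A); apply: mxrankS.
  apply: (submx_rowsub (fun i => enum_rank_in (fT i) (f i))) => i /=.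
  by rewrite enum_rankK_in.
have nub0 : 0 < nubar X (\rank X).
  apply: lt_le_trans nuT _; apply: le_bigmax_cond; exact/eqP.
have : nubar X (\rank X) = 0 \/
    exists T' : {set 'I_p}, #|T'| = \rank X /\ nubar X (\rank X) = nu X T'.
  rewrite /nubar; pose Kp v := v = 0 \/ exists T' : {set 'I_p},
    #|T'| = \rank X /\ v = nu X T'.
  apply: (big_ind Kp); first by left.
  - by move=> x y Kx Ky; case: leP.
  - by move=> T' /eqP cT'; right; exists T'.
case=> [nub|[T' [cT' nub]]]; first by rewrite nub ltxx in nub0.
by exists T'; split => //; rewrite -nub.
Qed.

End nu_theory.

Lemma col_submx_range (R : realType) (n p : nat) (X : 'M[R]_(n, p))
    (T : {set 'I_p}) (v : 'cV[R]_p) :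
  row_free (col_submx X T)^T -> #|T| = \rank X ->
  exists w : 'cV[R]_#|T|, X *m v = col_submx X T *m w.
Proof.
move=> Tfree cT.
have XT : ((col_submx X T)^T <= X^T)%MS.
  by rewrite /col_submx trmx_mxsub rowsub_sub.
have /eqmxP : ((col_submx X T)^T == X^T)%MS.
  have [_ eqr] := mxrank_leqif_sup XT.
  by rewrite XT -eqr (mxrank_tr X) -cT; exact: Tfree.
move=> TX; have : (v^T *m X^T <= (col_submx X T)^T)%MS by rewrite TX submxMl.
case/submxP => D DE; exists D^T; apply: trmx_inj.
by rewrite !trmx_mul trmxK.
Qed.

(** Extending [w] by zero outside [T] preserves both the image and the norm. *)
Lemma col_submx_extension (R : realType) (n p : nat) (X : 'M[R]_(n, p))
    (T : {set 'I_p}) (w : 'cV[R]_#|T|) :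
  exists2 v : 'cV[R]_p, X *m v = col_submx X T *m w & l1norm v <= l1norm w.
Proof.
exists (colsub (fun k : 'I_#|T| => enum_val k) 1%:M *m w).
  by rewrite mulmxA mulmx_colsub mulmx1.
rewrite /l1norm.
apply: (@le_trans _ _ (\sum_i \sum_k (i == enum_val k)%:R * `|w k ord0|)).
  apply: ler_sum => i _; rewrite mxE; apply: le_trans (ler_norm_sum _ _ _) _.
  by apply: ler_sum => k _; rewrite !mxE normrM normr_nat.
rewrite exchange_big/=; apply: ler_sum => k _.
rewrite (bigD1 (enum_val k))//= eqxx mul1r big1 ?addr0// => i /negbTE ->.
by rewrite mul0r.
Qed.

(** * The prediction bound *)

(** The perturbation [v] of [betahat] satisfies [X v = z] and is supported on
    [T], so that [nu X T] controls its l1 norm by the length [L] of [z]. *)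
Lemma lasso_prediction_bound (R : realType) (n p r : nat) (X : 'M[R]_(n, p))
    (betastar betahat : 'cV[R]_p) (xi : 'cV[R]_n) (lambda : R)
    (T : {set 'I_p}) (Q : 'M[R]_(r, n)) :
  (0 < n)%N -> 0 <= lambda ->
  lasso_solution X (X *m betastar + xi) lambda betahat ->
  #|T| = \rank X -> 0 < nu X T -> Q *m Q^T = 1%:M -> (X^T <= Q)%MS ->
  prediction_loss X betahat betastar <=
    2 * lambda ^+ 2 * (\rank X)%:R / nu X T ^+ 2
    + 2 * dot (Q *m xi) (Q *m xi) / n%:R.
Proof.
move=> n0 lam0 sol cT nu0 QQ XQ.
have N0 : 0 < n%:R :> R by rewrite ltr0n.
have [w zw] := col_submx_range (betastar - betahat) (nu_gt0_row_free n0 nu0) cT.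
have [v vw lvw] := col_submx_extension X w.
set z := X *m (betastar - betahat) in zw; rewrite -zw in vw.
have fo := lasso_first_order v n0 lam0 sol.
rewrite vw addrAC -mulmxBr -/z dotDl in fo.
have cTR : #|T|%:R = (\rank X)%:R :> R by rewrite cT.
have nuw := nu_le X n0 w; rewrite -zw cTR in nuw.
have Qxz : dot (Q *m xi) (Q *m z) = dot xi z.
  by apply: dot_orthonormal => //; rewrite /z trmx_mul (submx_trans (submxMl _ _)).
have Qzz : dot (Q *m z) (Q *m z) = dot z z.
  by apply: dot_orthonormal => //; rewrite /z trmx_mul (submx_trans (submxMl _ _)).
(* [- <xi, z> <= |Q xi| ^+ 2 + L ^+ 2 / 4], from a square that is nonnegative. *)
have young := dot_ge0 (Q *m xi + 2^-1 *: (Q *m z)).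
rewrite !(dotDl, dotDr, dotZl, dotZr) Qzz (dotC (Q *m z)) Qxz in young.
set g := dot (Q *m xi) _ in young *.
set sN := Num.sqrt n%:R in nuw; set sr := Num.sqrt (\rank X)%:R in nuw.
have sN0 : 0 < sN by rewrite sqrtr_gt0.
have sNN : n%:R = sN ^+ 2 by rewrite sqr_sqrtr// ler0n.
have srr : (\rank X)%:R = sr ^+ 2 by rewrite sqr_sqrtr// ler0n.
have -> : prediction_loss X betahat betastar = dot z z / n%:R.
  by rewrite /prediction_loss l2norm_sqr -opprB mulmxN dotNl dotNr opprK mulrC.
set L := l2norm z in nuw.
have LL : dot z z = L ^+ 2 by rewrite -l2norm_sqr.
rewrite LL in fo young *; rewrite sNN srr in fo *.
set nuT := nu X T in nu0 nuw *.
pose a := lambda * sN * sr / nuT.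
have h1 : sN ^+ 2 * lambda * l1norm v <= a * L.
  have : nuT * (sN * l1norm v) <= sr * L.
    by apply: le_trans nuw; rewrite !ler_wpM2l// ltW.
  move=> /(ler_wpM2l (_ : 0 <= sN * lambda / nuT)).
  have c0 : 0 <= sN * lambda / nuT by rewrite divr_ge0 ?mulr_ge0// ltW.
  move=> /(_ c0).
  rewrite (_ : sN * lambda / nuT * (nuT * _) = sN ^+ 2 * lambda * l1norm v);
    last by field; rewrite gt_eqF.
  by rewrite (_ : sN * lambda / nuT * _ = a * L)//; rewrite /a; ring.
(* The second Young inequality: [a * L <= a ^+ 2 + L ^+ 2 / 4]. *)
have h2 : 0 <= (a - L / 2) ^+ 2 by exact: sqr_ge0.
have h3 : L ^+ 2 <= 2 * a ^+ 2 + 2 * g.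
  have -> : a ^+ 2 = (a - L / 2) ^+ 2 + a * L - L ^+ 2 / 4 by field.
  by lra.
rewrite ler_pdivrMr ?exprn_gt0//; apply: le_trans h3 _.
rewrite le_eqVlt; apply/orP; left; apply/eqP; rewrite /a.
by field; rewrite !gt_eqF.
Qed.

Theorem mainTheorem1 (R : realType) (n p : nat) (hn : (1 <= n)%N)
    (hp : (2 <= p)%N) (X : 'M[R]_(n, p)) (hX0 : X != 0)
    (hX : forall j : 'I_p, l2norm (col j X) ^+ 2 <= n%:R)
    (betastar : 'cV[R]_p) (sigma : R) (hsigma : 0 < sigma)
    (d : measure_display) (Omega : measurableType d) (P : probability Omega R)
    (xi : 'I_n -> {RV P >-> R}) (hxi : gaussian_noise xi sigma)
    (y : Omega -> 'cV[R]_n)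
    (hy : forall w : Omega, y w = X *m betastar + \col_(i < n) xi i w)
    (lambda : R) (hlambda : lambda = Num.sqrt (2 * ln p%:R / n%:R))
    (betahat : Omega -> 'cV[R]_p)
    (hbetahat : forall w : Omega, lasso_solution X (y w) lambda (betahat w))
    (delta : R) (hdelta0 : 0 < delta) (hdelta1 : delta < 1) :
  with_prob_ge P (1 - delta)
    [set w : Omega |
      prediction_loss X (betahat w) betastar <=
        4 * ln p%:R * (\rank X)%:R / (n%:R * nubar X (\rank X) ^+ 2)
        + 4 * sigma ^+ 2 * ((\rank X)%:R + 2 * ln (1 / delta)) / n%:R].
Proof.
have n0 : 0 < n%:R :> R by rewrite ltr0n.
have lnp : 0 <= ln p%:R :> R by rewrite ln_ge0// ler1n ltnW.
have lam0 : 0 <= lambda by rewrite hlambda sqrtr_ge0.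
have lam2 : lambda ^+ 2 = 2 * ln p%:R / n%:R.
  by rewrite hlambda sqr_sqrtr// divr_ge0 ?mulr_ge0// ltW.
have [T [cT nuT nubarT]] := nubar_attained hn hX0.
have [Q QQ XQ] := orthonormal_rows X^T.
have := orthonormal_projection_tail hsigma hxi QQ hdelta0.
have rX : (\rank X^T)%:R = (\rank X)%:R :> R by rewrite mxrank_tr.
move=> [A [mA sub PA]]; exists A; split=> // w /sub /=.
rewrite rX => tail.
have sol := hbetahat w; rewrite hy in sol.
apply: le_trans (lasso_prediction_bound hn lam0 sol cT nuT QQ XQ) _.
rewrite nubarT lam2; apply: lerD.
  rewrite le_eqVlt; apply/orP; left; apply/eqP.
  by field; rewrite !gt_eqF.
rewrite ler_pM2r ?invr_gt0//.
by apply: le_trans (ler_wpM2l _ tail) _ => //; lra.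
Qed.
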